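(* There is an absolute constant $C>0$ such that for every real $\alpha>1$, with $\delta=(e(\alpha+1))^{1-\alpha}$ (here $e$ in $\delta$ is Euler's number), the greedy integer assignment algorithm for online load balancing on unrelated machines is $(C\alpha)^\alpha$-competitive (i.e. $O(\alpha)^\alpha$-competitive): for every instance, if $\widetilde x_{jk}\in\{0,1\}$ is the assignment it produces, then $$\sum_{k}\Big(\sum_j \ell_{jk}\widetilde x_{jk}\Big)^\alpha\le (C\alpha)^\alpha\cdot\mathrm{OPT},$$ where $\mathrm{OPT}$ is the minimum of $\sum_k\big(\sum_j \ell_{jk}X_{jk}\big)^\alpha$ over all integral assignments, i.e. $X_{jk}\in\{0,1\}$ with $\sum_k X_{jk}=1$ for every job $j$.
   Context: Online integer load balancing: there are machines $k=1,\dots,m$ ($m\ge 1$) and jobs $j=1,\dots,n$ arriving one by one in this order. When job $j$ arrives, the numbers $\ell_{jk}>0$ (load of job $j$ on machine $k$) are revealed for all $k$, and $j$ must be irrevocably assigned to exactly one machine. Greedy integer assignment algorithm with parameter $\delta$: when job $j$ arrives, it picks a machine $k$ minimizing $$\delta\,\alpha\,\ell_{jk}\Big(\sum_{i<j}\ell_{ik}x_{ik}\Big)^{\alpha-1}+\ell_{jk}^\alpha$$ (ties broken arbitrarily) and sets $x_{jk}=1$ and $x_{jk'}=0$ for $k'\ne k$. *)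

(* Defs.v *)
From HB Require Import structures.
From mathcomp Require Import all_boot all_order all_algebra.
From mathcomp Require Import all_classical all_reals all_analysis.
Set Implicit Arguments.
Unset Strict Implicit.
Unset Printing Implicit Defensive.
Import Order.TTheory GRing.Theory Num.Theory.
Local Open Scope classical_set_scope.
Local Open Scope ring_scope.

(* An instance is a matrix l, where l j k is the load of job j on machine k;
   jobs arrive in the order of the ordinals of 'I_n.  An assignment is a
   0/1 matrix X, booleans being read as numbers via %:R. *)

Definition integral_assignment (n m : nat) (X : 'M[bool]_(n, m)) : Prop :=
  forall j : 'I_n, (\sum_(k < m) X j k)%N = 1%N.

Definition cost (R : realType) (n m : nat) (l : 'M[R]_(n, m)) (alpha : R)
    (X : 'M[bool]_(n, m)) : R :=
  \sum_(k < m) (\sum_(j < n) l j k * (X j k)%:R) `^ alpha.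

Definition OPT (R : realType) (n m : nat) (l : 'M[R]_(n, m)) (alpha : R) : R :=
  inf [set cost l alpha X | X in @integral_assignment n m].

Definition greedy_objective (R : realType) (n m : nat) (l : 'M[R]_(n, m))
    (alpha delta : R) (x : 'M[bool]_(n, m)) (j : 'I_n) (k : 'I_m) : R :=
  delta * alpha * l j k
    * (\sum_(i < n | (i < j)%N) l i k * (x i k)%:R) `^ (alpha - 1)
  + l j k `^ alpha.

(* x is a possible output of the greedy algorithm, under some tie-breaking.
   This determines x row by row, as greedy_objective _ _ _ x j only depends on
   the rows of x before j. *)
Definition greedy_output (R : realType) (n m : nat) (l : 'M[R]_(n, m))
    (alpha delta : R) (x : 'M[bool]_(n, m)) : Prop :=
  forall j : 'I_n, exists k : 'I_m,
    (forall k' : 'I_m, greedy_objective l alpha delta x j k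
                         <= greedy_objective l alpha delta x j k') /\
    (forall k' : 'I_m, x j k' = (k' == k)).

(* The infimum in OPT is a minimum. *)
Lemma OPT_le (R : realType) (n m : nat) (l : 'M[R]_(n, m)) (alpha : R)
    (X : 'M[bool]_(n, m)) :
  integral_assignment X -> OPT l alpha <= cost l alpha X.
Proof.
move=> hX; apply: ge_inf; last by exists X.
by exists 0 => _ [Y _ <-]; apply: sumr_ge0 => k _; apply: powR_ge0.
Qed.

Lemma OPT_attained (R : realType) (n m : nat) (l : 'M[R]_(n, m)) (alpha : R) :
  (0 < m)%N ->
  exists2 X, integral_assignment X & OPT l alpha = cost l alpha X.
Proof.
case: m l => // m l _.
pose X0 : 'M[bool]_(n, m.+1) := \matrix_(j, k) (k == ord0).
have X0P : `[< integral_assignment X0 >].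
  apply/asboolP => j; rewrite (bigD1 ord0) //= mxE eqxx big1 // => k kn0.
  by rewrite mxE (negbTE kn0).
case: (@Order.TotalTheory.arg_minP _ _ _ X0
  (fun X => `[< integral_assignment X >]) (cost l alpha) X0P) => X /asboolP XP minX.
exists X => //; apply/eqP; rewrite eq_le OPT_le //=.
apply: lb_le_inf; first by exists (cost l alpha X); exists X.
by move=> _ [Y YP <-]; apply: minX; apply/asboolP.
Qed.

(* Main.v *)
Require Import Defs.
From HB Require Import structures.
From mathcomp Require Import all_boot all_order all_algebra.
From mathcomp Require Import all_classical all_reals all_analysis.
From mathcomp Require Import ring lra.
Import Order.TTheory GRing.Theory Num.Theory.
Local Open Scope ring_scope.

(** Let [S k j] be the greedy load of machine [k] before job [j], [G k] its final
    greedy load and [O k] its load in an optimal assignment.  If job [j] goes to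
    [k], then the mean value theorem bounds the increase of the cost by
    [alpha * l j k * (S k j + l j k) `^ (alpha - 1)].  Comparing [S k j] with
    [alpha * l j k] bounds this, after multiplication by [delta], by [expR 1] times
    the greedy objective; the value of [delta] balances the two cases.  Greedy
    minimality replaces its choices by the optimal ones, and
    monotonicity replaces [S] by [G], so with [e = expR 1]
      sum G^alpha <= e alpha (sum O G^(alpha-1)) + (e / delta) (sum O^alpha).
    The cross term is absorbed machine by machine, by comparing
    [G k] with [2 e alpha O k]. *)

Section PowerInequalities.
Variables (R : realType) (a : R).

(** Young's inequality for the product of [x] and y^(a-1), with conjugate exponents [a] and
    [a / (a - 1)]; no derivative is taken and [x], [y] may come in either order. *)
Lemma powRB_le_tangent (a1 : 1 < a) (x y : R) : 0 <= x -> 0 <= y ->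
  y `^ a - x `^ a <= a * (y - x) * y `^ (a - 1).
Proof.
move=> x0 y0.
have a0 : 0 < a by lra.
have b0 : 0 < a - 1 by lra.
have an0 : a != 0 by rewrite gt_eqF.
have bn0 : a - 1 != 0 by rewrite gt_eqF.
have q0 : 0 < a / (a - 1) by rewrite divr_gt0.
have pq : a^-1 + (a / (a - 1))^-1 = 1 by field; rewrite an0 bn0.
have := conjugate_powR x0 (powR_ge0 y (a - 1)) a0 q0 pq.
rewrite -powRrM (_ : (a - 1) * (a / (a - 1)) = a); last by field.
rewrite -(ler_pM2l a0) => young.
have E : a * (x `^ a / a + y `^ a / (a / (a - 1))) = x `^ a + (a - 1) * y `^ a.
  by field; rewrite an0 bn0.
have Y := mulr_powRB1 y0 a0.
move: young; rewrite E => young.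
have -> : a * (y - x) * y `^ (a - 1)
   = a * (y * y `^ (a - 1)) - a * (x * y `^ (a - 1)) by ring.
by rewrite Y; lra.
Qed.

(** From 1 + 1/a <= exp(1/a): the power [a - 1] gives the exponent (a-1)/a, which is below 1. *)
Lemma powR1DV_le (a1 : 1 < a) : (1 + a^-1) `^ (a - 1) <= expR 1.
Proof.
have a0 : 0 < a by lra.
have ia0 : 0 < a^-1 by rewrite invr_gt0.
apply: (@le_trans _ _ (expR a^-1 `^ (a - 1))).
  apply: ge0_ler_powR; rewrite ?nnegrE ?expR_ge0 ?expR_ge1Dx //; lra.
rewrite -expRM ler_expR mulrBr mulVf ?gt_eqF //; lra.
Qed.

Lemma powR_increment_le (a1 : 1 < a) (L u : R)
    (d := (expR 1 * (a + 1)) `^ (1 - a)) : 0 <= L -> 0 < u ->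
  d * ((L + u) `^ a - L `^ a)
    <= expR 1 * (d * a * u * L `^ (a - 1) + u `^ a).
Proof.
move=> L0 u0.
have a0 : 0 < a by lra.
have d0 : 0 <= d by exact: powR_ge0.
have e0 : 0 < expR 1 :> R by exact: expR_gt0.
have Lu0 : 0 <= L + u by lra.
have tang : (L + u) `^ a - L `^ a <= a * u * (L + u) `^ (a - 1).
  by have := powRB_le_tangent a1 _ _ L0 Lu0; rewrite (_ : L + u - L = u) //; ring.
apply: le_trans (ler_wpM2l d0 tang) _.
have [auL | Lau] := leP (a * u) L.
(* Large load: adding [u] enlarges [L] by a factor of at most 1 + 1/a, which costs at most [expR 1],
   so the first term of the objective pays. *)
- have h : (L + u) `^ (a - 1) <= L `^ (a - 1) * expR 1.
    have ia0 : 0 <= 1 + a^-1 by rewrite addr_ge0 // invr_ge0 ltW.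
    have : L + u <= L * (1 + a^-1).
      by rewrite mulrDr mulr1 lerD2l ler_pdivlMr // mulrC.
    move=> Lu; apply: (@le_trans _ _ ((L * (1 + a^-1)) `^ (a - 1))).
      by apply: ge0_ler_powR; rewrite ?nnegrE ?mulr_ge0 //; lra.
    by rewrite powRM // ler_wpM2l ?powR_ge0 // powR1DV_le.
  have dau : 0 <= d * (a * u) by rewrite !mulr_ge0 // ltW.
  have := ler_wpM2l dau h; have := mulr_ge0 (ltW e0) (powR_ge0 u a); lra.
(* Small load: L + u <= (a+1) u. The factor [d] cancels (a+1)^(a-1) and leaves exp(1-a), which also
   absorbs [a], so the term u^a pays. *)
- have h : (L + u) `^ (a - 1) <= (a + 1) `^ (a - 1) * u `^ (a - 1).
    rewrite -powRM; try lra.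
    by apply: ge0_ler_powR; rewrite ?nnegrE ?mulr_ge0 //; lra.
  have dE : d * (a + 1) `^ (a - 1) = expR (1 - a).
    rewrite /d powRM ?ltW //; last lra.
    rewrite -mulrA -(opprB a 1) [X in _ * (X * _)]powRN mulVf.
      by rewrite mulr1 opprB -expRM mul1r.
    by rewrite gt_eqF // powR_gt0 //; lra.
  have aE : a * expR (1 - a) <= expR 1.
    rewrite expRD expRN mulrCA ler_piMr ?(ltW e0) // ler_pdivrMr ?expR_gt0 // mul1r.
    by have := expR_ge1Dx a; lra.
  have dau : 0 <= d * (a * u) by rewrite !mulr_ge0 // ltW.
  have := ler_wpM2l dau h.
  have -> : d * (a * u) * ((a + 1) `^ (a - 1) * u `^ (a - 1)) =
    a * (d * (a + 1) `^ (a - 1)) * (u * u `^ (a - 1)) by ring.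
  rewrite dE mulr_powRB1 ?(ltW u0) // => h1.
  have h2 := ler_wpM2r (powR_ge0 u a) aE.
  have h3 : 0 <= expR 1 * (d * (a * u) * L `^ (a - 1)).
    by rewrite mulr_ge0 ?(ltW e0) // mulr_ge0 // powR_ge0.
  lra.
Qed.

(** Whichever of [G] and [2 * v] is larger, its own term on the right already suffices. *)
Lemma mulr_powRB1_le_half (a1 : 1 < a) (v G : R) : 0 <= v -> 0 <= G ->
  v * G `^ (a - 1) <= G `^ a / 2 + (2 * v) `^ a / 2.
Proof.
move=> v0 G0.
have a0 : 0 < a by lra.
have v20 : 0 <= 2 * v by lra.
have G1 := mulr_powRB1 G0 a0; have v1 := mulr_powRB1 v20 a0.
have := powR_ge0 G a; have := powR_ge0 (2 * v) a.
have [vG | Gv] := leP (2 * v) G.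
- have := ler_wpM2r (powR_ge0 G (a - 1)) vG; lra.
- have : G `^ (a - 1) <= (2 * v) `^ (a - 1).
    by apply: ge0_ler_powR; rewrite ?nnegrE //; lra.
  move/(ler_wpM2l v0); lra.
Qed.

(** In each f_i^a = f_i f_i^(a-1), bound the second factor by the (a-1)-th power of the whole
    sum. *)
Lemma sum_powR_le_powR_sum (a1 : 1 < a) (I : finType) (f : I -> R) :
  (forall i, 0 <= f i) -> \sum_i f i `^ a <= (\sum_i f i) `^ a.
Proof.
move=> f0; have a0 : 0 < a by lra.
have F0 : 0 <= \sum_i f i by exact: sumr_ge0.
rewrite -(mulr_powRB1 F0 a0) mulr_suml; apply: ler_sum => i _.
rewrite -(mulr_powRB1 (f0 i) a0) ler_wpM2l //.
apply: ge0_ler_powR; rewrite ?nnegrE //; first by lra.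
by rewrite (bigD1 i) //= lerDl sumr_ge0.
Qed.

End PowerInequalities.

Section Greedy.
Variables (R : realType) (n m : nat) (l : 'M[R]_(n, m)).
Hypothesis l0 : forall j k, 0 < l j k.
Variable a : R.
Hypothesis a1 : 1 < a.

Let a0 : 0 < a. Proof. exact: lt_trans a1. Qed.

Let aB1_ge0 : 0 <= a - 1. Proof. by rewrite subr_ge0 ltW. Qed.

(** The time [t] is a natural number, not an ordinal, so that the telescoping sum can reach [t = n],
    the final load. *)
Definition load_before (x : 'M[bool]_(n, m)) (k : 'I_m) (t : nat) : R :=
  \sum_(i < n | (i < t)%N) l i k * (x i k)%:R.

Definition load (x : 'M[bool]_(n, m)) (k : 'I_m) : R :=
  \sum_(i < n) l i k * (x i k)%:R.

Lemma entry_ge0 (x : 'M[bool]_(n, m)) i k : 0 <= l i k * (x i k)%:R.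
Proof. by rewrite mulr_ge0 // ltW. Qed.

Lemma load_before_ge0 x k t : 0 <= load_before x k t.
Proof. by apply: sumr_ge0 => i _; exact: entry_ge0. Qed.

Lemma load_ge0 x k : 0 <= load x k.
Proof. by apply: sumr_ge0 => i _; exact: entry_ge0. Qed.

Lemma load_before_le x k t : load_before x k t <= load x k.
Proof.
rewrite /load_before big_mkcond /=; apply: ler_sum => i _.
by case: ifP => // _; exact: entry_ge0.
Qed.

Lemma load_beforeS x k (j : 'I_n) :
  load_before x k j.+1 = load_before x k j + l j k * (x j k)%:R.
Proof.
rewrite /load_before (bigD1 j) //= addrC; congr (_ + _).
by apply: eq_bigl => i; rewrite ltnS ltn_neqAle andbC.
Qed.

Lemma powR_load_telescope x k :
  load x k `^ a =
  \sum_(j < n) (load_before x k j.+1 `^ a - load_before x k j `^ a).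
Proof.
rewrite -(big_mkord xpredT
  (fun j => load_before x k j.+1 `^ a - load_before x k j `^ a)).
rewrite (telescope_sumr (fun j => load_before x k j `^ a)) //.
have -> : load_before x k n = load x k.
  by apply: eq_bigl => i; rewrite ltn_ord.
(* The initial term is 0^a, which vanishes because [a] is nonzero; 0^0 would be 1. *)
by rewrite /load_before big_pred0 // powR0 ?subr0 // gt_eqF //; lra.
Qed.

Lemma greedy_objective_ge0 (d : R) (x : 'M[bool]_(n, m)) j k :
  0 <= d -> 0 <= greedy_objective l a d x j k.
Proof.
move=> d0; rewrite addr_ge0 ?powR_ge0 // !mulr_ge0 ?powR_ge0 //; exact: ltW.
Qed.

(** The left side is the minimum of the objective over machines; the right side is an average of it,
    as the weights [X j k] sum to 1. *)
Lemma greedy_row_le (d : R) (x X : 'M[bool]_(n, m)) (j : 'I_n) :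
  greedy_output l a d x -> integral_assignment X ->
  \sum_k (x j k)%:R * greedy_objective l a d x j k
    <= \sum_k (X j k)%:R * greedy_objective l a d x j k.
Proof.
move=> /(_ j) [k0 [kmin xk0]] /(_ j) XP.
rewrite (bigD1 k0) //= xk0 eqxx mul1r big1 ?addr0; last first.
  by move=> k kk0; rewrite xk0 (negbTE kk0) mul0r.
rewrite -[leLHS]mul1r -[X in X * _](_ : (\sum_k X j k)%:R = 1 :> R); last by rewrite XP.
rewrite natr_sum mulr_suml; apply: ler_sum => k _.
by rewrite ler_wpM2l.
Qed.

Lemma greedy_cost_le_objective (x : 'M[bool]_(n, m))
    (d := (expR 1 * (a + 1)) `^ (1 - a)) :
  d * cost l a x <=
  expR 1 * \sum_j \sum_k (x j k)%:R * greedy_objective l a d x j k.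
Proof.
rewrite exchange_big /= /cost !mulr_sumr; apply: ler_sum => k _.
rewrite -/(load x k) powR_load_telescope !mulr_sumr; apply: ler_sum => j _.
rewrite load_beforeS; case: (x j k).
- by rewrite mulr1 mul1r powR_increment_le ?load_before_ge0.
- by rewrite mulr0 addr0 subrr mulr0 mul0r mulr0.
Qed.

(** Past loads are at most final loads, and superadditivity of the power collects the terms l_jk^a
    of the jobs that [X] puts on [k]. *)
Lemma objective_le_load (d : R) (x X : 'M[bool]_(n, m)) : 0 <= d ->
  \sum_j \sum_k (X j k)%:R * greedy_objective l a d x j k
  <= \sum_k (d * a * load X k * load x k `^ (a - 1) + load X k `^ a).
Proof.
move=> d0; rewrite exchange_big /=; apply: ler_sum => k _.
apply: le_trans (lerD (lexx _) (sum_powR_le_powR_sum _ a a1 _ _ (fun j => entry_ge0 X j k))).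
rewrite [X in d * a * X]/load mulr_sumr mulr_suml -big_split /=.
apply: ler_sum => j _; rewrite -/(load_before x k j).
case: (X j k); last by rewrite mul0r !mulr0 mul0r add0r powR_ge0.
rewrite mul1r mulr1 lerD2r.
rewrite ler_wpM2l //; first by rewrite !mulr_ge0 //; exact: ltW.
by apply: ge0_ler_powR; rewrite ?nnegrE ?load_before_ge0 ?load_ge0 ?load_before_le.
Qed.

Lemma greedy_cost_le (x X : 'M[bool]_(n, m)) :
  greedy_output l a ((expR 1 * (a + 1)) `^ (1 - a)) x ->
  integral_assignment X ->
  cost l a x <= (8 * expR 1 * a) `^ a * cost l a X.
Proof.
set d := _ `^ (1 - a) => xP XP.
have a1' := a1. (* [lra] ignores section hypotheses *)
have e0 : 0 < expR 1 :> R by exact: expR_gt0.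
have e1 : 1 <= expR 1 :> R by have := expR_ge1Dx (1 : R); lra.
have ea0 : 0 < expR 1 * (a + 1) by rewrite mulr_gt0 //; lra.
have d0 : 0 < d by exact: powR_gt0.
pose P := expR 1 * a.
have P0 : 0 < P by exact: mulr_gt0.
have P20 : 0 <= 2 * P by lra.
(* Here 1/d = (e(a+1))^(a-1), and both e and e(a+1) are at most 2ea = 2P. *)
have dV : expR 1 / d <= (2 * P) `^ a.
  rewrite /d -powRN opprB -(mulr_powRB1 P20 a0).
  apply: ler_pM; rewrite ?powR_ge0 ?(ltW e0) //.
    by have := ler_wpM2l (ltW e0) (ltW a1); rewrite /P; lra.
  apply: ge0_ler_powR; rewrite ?nnegrE ?(ltW ea0) //; rewrite /P.
  by rewrite mulrCA ler_wpM2l ?(ltW e0) //; lra.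
have step1 : cost l a x <=
    \sum_k (P * load X k * load x k `^ (a - 1) + expR 1 / d * load X k `^ a).
  rewrite -(ler_pM2l d0); apply: le_trans (greedy_cost_le_objective x) _.
  rewrite -/d; apply: (@le_trans _ _ (expR 1 *
      \sum_k (d * a * load X k * load x k `^ (a - 1) + load X k `^ a))).
    rewrite ler_wpM2l ?(ltW e0) //.
    apply: le_trans (objective_le_load _ x _ (ltW d0)).
    by apply: ler_sum => j _; exact: greedy_row_le.
  rewrite !mulr_sumr; apply: ler_sum => k _; rewrite le_eqVlt; apply/orP; left.
  by apply/eqP; rewrite /P; field; rewrite gt_eqF.
(* The cross term yields half the greedy cost plus (2P)^a / 2 times the optimal one; [dV] adds
   another (2P)^a, and 3/2 is rounded up to 2. *)
have step2 : cost l a x <= cost l a x / 2 + 2 * (2 * P) `^ a * cost l a X.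
  apply: le_trans step1 _; rewrite /cost mulr_suml mulr_sumr -big_split /=.
  apply: ler_sum => k _; rewrite -/(load x k) -/(load X k).
  have PX0 : 0 <= P * load X k by rewrite mulr_ge0 ?load_ge0 // ltW.
  have := mulr_powRB1_le_half _ a a1 _ _ PX0 (load_ge0 x k).
  rewrite (mulrA 2 P) (powRM _ P20 (load_ge0 X k)).
  have := ler_wpM2r (powR_ge0 (load X k) a) dV.
  have := mulr_ge0 (powR_ge0 (2 * P) a) (powR_ge0 (load X k) a).
  lra.
(* Solving [step2] for the greedy cost doubles its constant 2 to 4, and 4 <= 4^a moves it under the
   power; hence 8 = 4 * 2. *)
have four : 4 * (2 * P) `^ a <= (8 * expR 1 * a) `^ a.
  rewrite (_ : 8 * expR 1 * a = 4 * (2 * P)); last by rewrite /P; ring.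
  by rewrite (powRM _ _ P20) // ler_wpM2r ?powR_ge0 // le1r_powR ?ler1n // ltW.
have X0 : 0 <= cost l a X by apply: sumr_ge0 => k _; exact: powR_ge0.
have := ler_wpM2r X0 four; lra.
Qed.

End Greedy.

Theorem mainTheorem3 (R : realType) :
  exists C : R, 0 < C /\
    forall (alpha : R), 1 < alpha ->
    forall (m n : nat) (l : 'M[R]_(n, m)) (x : 'M[bool]_(n, m)),
      (1 <= m)%N ->
      (forall (j : 'I_n) (k : 'I_m), 0 < l j k) ->
      greedy_output l alpha ((expR 1 * (alpha + 1)) `^ (1 - alpha)) x ->
      cost l alpha x <= (C * alpha) `^ alpha * OPT l alpha.
Proof.
exists (8 * expR 1); split; first by rewrite mulr_gt0 ?expR_gt0.
move=> alpha alpha1 m n l x m1 l0 xP.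
have [X XP ->] := OPT_attained l alpha m1.
exact: greedy_cost_le.
Qed.
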